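(* Let $n>1$. The product-preserving functors $\det:M_n(\mathcal{L})\to(\mathcal{L},\otimes)$ and $\operatorname{Det}=\det\circ\Lambda_*:M_n(\mathcal{V})\to(\mathcal{L},\otimes)$ are not monoidal, and neither are their restrictions to the weakly invertible matrices $\mathrm{Gl}_n(\mathcal{L})$ and $\mathrm{Gl}_n(\mathcal{V})$. More precisely: evaluated on any associativity isomorphism $c$ of the matrix product, $\det$ (respectively $\operatorname{Det}$) gives a morphism of the form $(d,s)$ with $d\in\mathbb{Z}$ and $s\in\{\pm1\}$, and there exist triples of matrices (even weakly invertible ones) for whose associativity isomorphism $s=-1$.
   Context: $\mathcal{V}$: the category with objects $\mathbb{C}^n$ ($n\ge0$) and morphisms $\operatorname{Aut}(\mathbb{C}^n)=\mathrm{Gl}_n(\mathbb{C})$, bipermutative under direct sum (block sum) and tensor product (lexicographically ordered bases). Its coherence isomorphisms are the evident permutation matrices. $\mathcal{L}$: the category with objects $\mathbb{C}_n$ ($n\in\mathbb{Z}$) and only automorphisms $\operatorname{Aut}(\mathbb{C}_n)=\mathbb{C}^*$. Morphisms are written $(n,a)\in\mathbb{Z}\times\mathbb{C}^*$, with $(n,a)\oplus(m,b)=(n+m,ab)$ and $(n,a)\otimes(m,b)=(nm,a^mb^n)$. It is bipermutative with additive twist $(n+m,(-1)^{nm})$ and multiplicative twist $(nm,(-1)^{n(n-1)m(m-1)/4})$. Associativity and unit isomorphisms are identities and right distributivity is strict. The left distributivity isomorphism is $A\otimes(B\oplus C)\to(B\oplus C)\otimes A=(B\otimes A)\oplus(C\otimes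 A)\to(A\otimes B)\oplus(A\otimes C)$, built from multiplicative twists. $\Lambda:\mathcal{V}\to\mathcal{L}$ is the bipermutative functor $\mathbb{C}^n\mapsto\mathbb{C}_n$, $f\mapsto(n,\det f)$. For a bipermutative category $\mathcal{B}$, $M_n(\mathcal{B})$ is the monoidal category whose objects (morphisms) are $n\times n$ matrices of objects (morphisms) of $\mathcal{B}$, with product $(E\cdot F)_{ik}=\bigoplus_{j=1}^n E_{ij}\otimes F_{jk}$. Its associativity isomorphism $(E\cdot F)\cdot G\to E\cdot(F\cdot G)$ is, entry by entry, the canonical coherence isomorphism of $\mathcal{B}$ (distributivity isomorphisms and permutation of summands). Its unit is strict. $\Lambda_*:M_n(\mathcal{V})\to M_n(\mathcal{L})$ applies $\Lambda$ entrywise and is strict monoidal. On morphisms, $(\mathbb{Z}\times\mathbb{C}^*,\oplus,\otimes)$ is strictly a commutative ring, with additive inverse $(n,a)\mapsto(-n,a^{-1})$. The functor $\det:M_n(\mathcal{L})\to\mathcal{L}$ is the usual determinant over this ring (on objects, the usual integer determinant), and it sends matrix products to $\otimes$. ''Not monoidal'' means that the functor does not carry the associativity isomorphisms of the source to those of $(\mathcal{L},\otimes)$, which are identities. $\mathrm{Gl}_n(\mathcal{L})$ and $\mathrm{Gl}_n(\mathcal{V})$ (''weakly invertible matrices'') are the full subcategories on objects whose image under $\det$, respectively $\operatorname{Det}$, is $\mathbb{C}_{1}$ or $\mathbb{C}_{-1}$. *)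

(* Defs.v *)
(* Everything is defined over a field K; the complex numbers are K = R[i]. *)
From HB Require Import structures.
From mathcomp Require Import all_boot all_order all_algebra.
From mathcomp Require Import ring.
From mathcomp Require Import complex mxtens.
From mathcomp Require Import boolp reals.

Set Implicit Arguments.
Unset Strict Implicit.
Unset Printing Implicit Defensive.

Import Order.TTheory GRing.Theory Num.Theory.

Local Open Scope ring_scope.

Record cat := Cat {
  cob :> Type;
  hom : cob -> cob -> Type;
  idm : forall a, hom a a;
  comp : forall a b c, hom b c -> hom a b -> hom a c;
  comp1m : forall a b (f : hom a b), comp (idm b) f = f;
  compm1 : forall a b (f : hom a b), comp f (idm a) = f;
  compA : forall a b c d (h : hom c d) (g : hom b c) (f : hom a b),
    comp h (comp g f) = comp (comp h g) f }.

Arguments idm {_} a.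
Arguments comp {_ _ _ _} _ _.
Declare Scope cat_scope.
Delimit Scope cat_scope with cat.
Local Open Scope cat_scope.
Notation "g \c f" := (comp g f) (at level 40, left associativity) : cat_scope.

(* The identity of a, seen as a morphism a -> b when a and b are equal objects:
   this is how the coherence isomorphisms that are identities are written. *)
Definition idto (C : cat) (a b : C) (e : a = b) : hom a b :=
  match e in _ = b' return hom a b' with erefl => idm a end.

(* The structure of a strictly unital monoidal category; the pentagon and the
   naturality of assoc are not recorded, since they play no role in saying what
   a monoidal functor is. *)
Record monData := MonData {
  mcat :> cat;
  tuno : mcat;
  tens : mcat -> mcat -> mcat;
  tensh : forall a a' b b' : mcat,
    hom a a' -> hom b b' -> hom (tens a b) (tens a' b');
  assoc : forall a b c : mcat, hom (tens (tens a b) c) (tens a (tens b c)) }.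

Arguments tuno {_}.
Arguments tens {_} _ _.
Arguments tensh {_ _ _ _ _} _ _.
Arguments assoc {_} _ _ _.

Record prodFunctor (C D : monData) := ProdFunctor {
  fob :> C -> D;
  fhom : forall a b : C, hom a b -> hom (fob a) (fob b);
  fhom_id : forall a, fhom (idm a) = idm (fob a);
  fhom_comp : forall a b c (g : hom b c) (f : hom a b),
    fhom (g \c f) = fhom g \c fhom f;
  fob1 : fob tuno = tuno;
  fobM : forall a b, fob (tens a b) = tens (fob a) (fob b);
  fhomM : forall a a' b b' (f : hom a a') (g : hom b b'),
    idto (fobM a' b') \c fhom (tensh f g) =
    tensh (fhom f) (fhom g) \c idto (fobM a b) }.

Arguments fhom {_ _} _ {_ _} _.
Arguments fobM {_ _} _ _ _.

(* The associativity hexagon for the structure isomorphisms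
   F (a b) = F a F b, which are identities. *)
Definition monoidal (C D : monData) (F : prodFunctor C D) : Prop :=
  forall a b c : C,
    tensh (idm (F a)) (idto (fobM F b c))
      \c idto (fobM F a (tens b c)) \c fhom F (assoc a b c) =
    assoc (F a) (F b) (F c)
      \c tensh (idto (fobM F a b)) (idm (F c)) \c idto (fobM F (tens a b) c).

Section Compose.
Variables (C D E : monData) (G : prodFunctor D E) (F : prodFunctor C D).

Lemma fhom_idto (A B : monData) (H : prodFunctor A B) (a b : A) (e : a = b) :
  fhom H (idto e) = idto (f_equal H e).
Proof. by case: b / e; rewrite /= fhom_id. Qed.

Lemma idto_trans (A : cat) (a b c : A) (e1 : a = b) (e2 : b = c) :
  idto (etrans e1 e2) = idto e2 \c idto e1.
Proof. by case: c / e2; rewrite /= comp1m. Qed.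

Let compF_fob a := G (F a).
Let compF_fhom a b (f : hom a b) : hom (compF_fob a) (compF_fob b) :=
  fhom G (fhom F f).

Lemma compF_id a : compF_fhom (idm a) = idm (compF_fob a).
Proof. by rewrite /compF_fhom !fhom_id. Qed.

Lemma compF_comp a b c (g : hom b c) (f : hom a b) :
  compF_fhom (g \c f) = compF_fhom g \c compF_fhom f.
Proof. by rewrite /compF_fhom !fhom_comp. Qed.

Lemma compF_1 : compF_fob tuno = tuno.
Proof. by rewrite /compF_fob !fob1. Qed.

Lemma compF_fobM a b :
  compF_fob (tens a b) = tens (compF_fob a) (compF_fob b).
Proof. exact: etrans (f_equal G (fobM F a b)) (fobM G (F a) (F b)). Defined.

Lemma compF_fhomM a a' b b' (f : hom a a') (g : hom b b') :
  idto (compF_fobM a' b') \c compF_fhom (tensh f g) =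
  tensh (compF_fhom f) (compF_fhom g) \c idto (compF_fobM a b).
Proof.
rewrite /compF_fhom /compF_fobM !idto_trans -!fhom_idto compA -fhomM.
by rewrite -!compA -!fhom_comp fhomM.
Qed.

Definition compF : prodFunctor C E :=
  ProdFunctor compF_id compF_comp compF_1 compF_fhomM.

End Compose.

Section FullSub.
Variables (M : monData) (P : pred M).
Hypotheses (P1 : P tuno) (PM : forall a b, P a -> P b -> P (tens a b)).

Definition fullsub_cat : cat :=
  @Cat {x : M | P x} (fun x y => hom (sval x) (sval y))
    (fun x => idm (sval x)) (fun x y z g f => g \c f)
    (fun x y f => comp1m f) (fun x y f => compm1 f)
    (fun x y z t h g f => compA h g f).

Definition fullsub : monData :=
  @MonData fullsub_cat (exist _ tuno P1)
    (fun x y => exist _ (tens (sval x) (sval y)) (PM (svalP x) (svalP y)))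
    (fun x x' y y' f g => tensh f g)
    (fun x y z => assoc (sval x) (sval y) (sval z)).

Lemma incl_fhomM (a a' b b' : fullsub)
    (f : @hom M (sval a) (sval a')) (g : @hom M (sval b) (sval b')) :
  idto (erefl (tens (sval a') (sval b'))) \c tensh f g =
  tensh f g \c idto (erefl (tens (sval a) (sval b))).
Proof. by rewrite /= comp1m compm1. Qed.

Definition incl : prodFunctor fullsub M :=
  @ProdFunctor fullsub M (fun x : fullsub => sval x) (fun x y f => f)
    (fun x => erefl) (fun x y z g f => erefl) erefl
    (fun a b => erefl) incl_fhomM.

End FullSub.

(* The structure of a bipermutative category that enters the associativity
   isomorphism of the matrix product. The equations on objects stand for the
   coherence isomorphisms that are identities; left distributivity is derived
   from the multiplicative twist. The coherence diagrams are not recorded: no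
   construction below uses them. *)
Record bipermData := BipermData {
  bcat :> cat;
  zeroo : bcat;
  oneo : bcat;
  addo : bcat -> bcat -> bcat;
  mulo : bcat -> bcat -> bcat;
  addh : forall a a' b b' : bcat,
    hom a a' -> hom b b' -> hom (addo a b) (addo a' b');
  mulh : forall a a' b b' : bcat,
    hom a a' -> hom b b' -> hom (mulo a b) (mulo a' b');
  addoA : forall a b c, addo a (addo b c) = addo (addo a b) c;
  add0o : forall a, addo zeroo a = a;
  addo0 : forall a, addo a zeroo = a;
  muloA : forall a b c, mulo a (mulo b c) = mulo (mulo a b) c;
  mul1o : forall a, mulo oneo a = a;
  mulo1 : forall a, mulo a oneo = a;
  mul0o : forall a, mulo zeroo a = zeroo;
  mulo0 : forall a, mulo a zeroo = zeroo;
  muloDl : forall a b c, mulo (addo a b) c = addo (mulo a c) (mulo b c);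
  twa : forall a b, hom (addo a b) (addo b a);
  twm : forall a b, hom (mulo a b) (mulo b a);
  addh1 : forall a b, addh (idm a) (idm b) = idm (addo a b);
  addh_comp : forall a a' a'' b b' b'' (f' : hom a' a'') (f : hom a a')
      (g' : hom b' b'') (g : hom b b'),
    addh (f' \c f) (g' \c g) = addh f' g' \c addh f g;
  mulh1 : forall a b, mulh (idm a) (idm b) = idm (mulo a b);
  mulh_comp : forall a a' a'' b b' b'' (f' : hom a' a'') (f : hom a a')
      (g' : hom b' b'') (g : hom b b'),
    mulh (f' \c f) (g' \c g) = mulh f' g' \c mulh f g;
  twaK : forall a b, twa b a \c twa a b = idm (addo a b);
  twmK : forall a b, twm b a \c twm a b = idm (mulo a b) }.

Arguments zeroo {_}.
Arguments oneo {_}.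
Arguments addo {_} _ _.
Arguments mulo {_} _ _.
Arguments addh {_ _ _ _ _} _ _.
Arguments mulh {_ _ _ _ _} _ _.
Arguments twa {_} _ _.
Arguments twm {_} _ _.

Section Coherence.
Variable B : bipermData.

Definition ldist (a b c : B) :
    hom (mulo a (addo b c)) (addo (mulo a b) (mulo a c)) :=
  addh (twm b a) (twm c a) \c idto (muloDl b c a) \c twm a (addo b c).

Definition ldistV (a b c : B) :
    hom (addo (mulo a b) (mulo a c)) (mulo a (addo b c)) :=
  twm (addo b c) a \c idto (esym (muloDl b c a)) \c addh (twm a b) (twm a c).

Lemma idtoK (C : cat) (x y : C) (e : x = y) : idto (esym e) \c idto e = idm x.
Proof. by case: y / e; rewrite /= comp1m. Qed.

Lemma idtoVK (C : cat) (x y : C) (e : x = y) : idto e \c idto (esym e) = idm y.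
Proof. by case: y / e; rewrite /= comp1m. Qed.

Lemma ldistK (a b c : B) : ldistV a b c \c ldist a b c = idm _.
Proof.
rewrite /ldistV /ldist !compA -(compA _ (addh _ _) (addh _ _)) -addh_comp !twmK.
by rewrite addh1 compm1 -(compA _ (idto _) (idto _)) idtoK compm1 twmK.
Qed.

Lemma ldistVK (a b c : B) : ldist a b c \c ldistV a b c = idm _.
Proof.
rewrite /ldistV /ldist !compA -(compA _ (twm _ _) (twm _ _)) twmK compm1.
by rewrite -(compA _ (idto _) (idto _)) idtoVK compm1 -addh_comp !twmK addh1.
Qed.

Fixpoint osum n : ('I_n -> B) -> B :=
  match n return ('I_n -> B) -> B with
  | 0%N => fun=> zeroo
  | n'.+1 => fun f => addo (f ord0) (osum (fun i => f (lift ord0 i)))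
  end.

Fixpoint hsum n : forall a b : 'I_n -> B,
    (forall i, hom (a i) (b i)) -> hom (osum a) (osum b) :=
  match n return forall a b : 'I_n -> B,
    (forall i, hom (a i) (b i)) -> hom (osum a) (osum b) with
  | 0%N => fun _ _ _ => idm zeroo
  | n'.+1 => fun a b f =>
      addh (f ord0) (@hsum n' (fun i => a (lift ord0 i))
                         (fun i => b (lift ord0 i)) (fun i => f (lift ord0 i)))
  end.

Lemma osum_mulDl n (f : 'I_n -> B) (c : B) :
  mulo (osum f) c = osum (fun i => mulo (f i) c).
Proof.
by elim: n f => [|n IHn] f /=; rewrite ?mul0o // muloDl IHn.
Qed.

Fixpoint ldistVn n (a : B) : forall f : 'I_n -> B,
    hom (osum (fun i => mulo a (f i))) (mulo a (osum f)) :=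
  match n return forall f : 'I_n -> B,
    hom (osum (fun i => mulo a (f i))) (mulo a (osum f)) with
  | 0%N => fun=> idto (esym (mulo0 a))
  | n'.+1 => fun f =>
      ldistV a (f ord0) (osum (fun i => f (lift ord0 i)))
        \c addh (idm (mulo a (f ord0))) (ldistVn a (fun i => f (lift ord0 i)))
  end.

Lemma addoACl (a b c d : B) :
  addo (addo a b) (addo c d) = addo a (addo (addo b c) d).
Proof. by rewrite !addoA. Qed.

Definition addoACA (a b c d : B) :
    hom (addo (addo a b) (addo c d)) (addo (addo a c) (addo b d)) :=
  idto (esym (addoACl a c b d))
    \c addh (idm a) (addh (twa b c) (idm d)) \c idto (addoACl a b c d).

Fixpoint osumD n : forall f g : 'I_n -> B,
    hom (addo (osum f) (osum g)) (osum (fun i => addo (f i) (g i))) :=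
  match n return forall f g : 'I_n -> B,
    hom (addo (osum f) (osum g)) (osum (fun i => addo (f i) (g i))) with
  | 0%N => fun _ _ => idto (add0o zeroo)
  | n'.+1 => fun f g =>
      addh (idm (addo (f ord0) (g ord0)))
           (osumD (fun i => f (lift ord0 i)) (fun i => g (lift ord0 i)))
        \c addoACA (f ord0) (osum (fun i => f (lift ord0 i)))
                   (g ord0) (osum (fun i => g (lift ord0 i)))
  end.

Lemma osum0 n : zeroo = osum (fun _ : 'I_n => @zeroo B).
Proof. by elim: n => //= n <-; rewrite add0o. Qed.

(* The permutation of summands exchanging two sums. *)
Fixpoint osum_swap n m : forall x : 'I_n -> 'I_m -> B,
    hom (osum (fun i => osum (fun j => x i j)))
        (osum (fun j => osum (fun i => x i j))) :=
  match n return forall x : 'I_n -> 'I_m -> B,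
    hom (osum (fun i => osum (fun j => x i j)))
        (osum (fun j => osum (fun i => x i j))) with
  | 0%N => fun=> idto (osum0 m)
  | n'.+1 => fun x =>
      osumD (x ord0) (fun j => osum (fun i => x (lift ord0 i) j))
        \c addh (idm (osum (x ord0))) (osum_swap (fun i => x (lift ord0 i)))
  end.

End Coherence.

Section MatrixCategory.
Variables (B : bipermData) (n : nat).

Lemma mat_comp1m (E F : 'I_n -> 'I_n -> B) (f : forall i j, hom (E i j) (F i j)) :
  (fun i j => idm (F i j) \c f i j) = f.
Proof.
by apply: functional_extensionality_dep => i;
   apply: functional_extensionality_dep => j; rewrite comp1m.
Qed.

Lemma mat_compm1 (E F : 'I_n -> 'I_n -> B) (f : forall i j, hom (E i j) (F i j)) :
  (fun i j => f i j \c idm (E i j)) = f.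
Proof.
by apply: functional_extensionality_dep => i;
   apply: functional_extensionality_dep => j; rewrite compm1.
Qed.

Lemma mat_compA (E F G H : 'I_n -> 'I_n -> B)
    (h : forall i j, hom (G i j) (H i j)) (g : forall i j, hom (F i j) (G i j))
    (f : forall i j, hom (E i j) (F i j)) :
  (fun i j => h i j \c (g i j \c f i j)) = (fun i j => h i j \c g i j \c f i j).
Proof.
by apply: functional_extensionality_dep => i;
   apply: functional_extensionality_dep => j; rewrite compA.
Qed.

Definition mat_cat : cat :=
  @Cat ('I_n -> 'I_n -> B) (fun E F => forall i j, hom (E i j) (F i j))
    (fun E i j => idm (E i j)) (fun E F G g f i j => g i j \c f i j)
    mat_comp1m mat_compm1 mat_compA.

Definition mat_one : mat_cat := fun i j => if i == j then oneo else zeroo.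

Definition mat_mul (E F : mat_cat) : mat_cat :=
  fun i k => osum (fun j => mulo (E i j) (F j k)).

Definition mat_mulh (E E' F F' : mat_cat) (f : hom E E') (g : hom F F') :
    hom (mat_mul E F) (mat_mul E' F') :=
  fun i k => hsum (fun j => mulh (f i j) (g j k)).

(* Right distributivity, permutation of the summands, associativity of the
   product and the inverse of left distributivity, in this order. *)
Definition mat_assoc (E F G : mat_cat) :
    hom (mat_mul (mat_mul E F) G) (mat_mul E (mat_mul F G)) :=
  fun i l =>
    hsum (fun j => ldistVn (E i j) (fun k => mulo (F j k) (G k l)))
    \c hsum (fun j => hsum (fun k => idto (esym (muloA (E i j) (F j k) (G k l)))))
    \c osum_swap (fun k j => mulo (mulo (E i j) (F j k)) (G k l))
    \c hsum (fun k => idto (osum_mulDl (fun j => mulo (E i j) (F j k)) (G k l))).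

Definition Mat : monData := MonData mat_one mat_mulh mat_assoc.

End MatrixCategory.

Section CategoryV.
Variable K : fieldType.

(* An isomorphism K^m -> K^n, acting on column vectors; it forces m = n, so that
   the morphisms n -> n are the elements of GL_n(K) (see vhom_unitmx). *)
Record vhom (m n : nat) := VHom {
  vmx :> 'M[K]_(n, m);
  vmxP : row_free vmx && row_full vmx }.

HB.instance Definition _ m n := [isSub for @vmx m n].

Lemma invertibleP m n (A : 'M[K]_(n, m)) (A' : 'M[K]_(m, n)) :
  A *m A' = 1%:M -> A' *m A = 1%:M -> row_free A && row_full A.
Proof.
by move=> h1 h2; apply/andP; split; [apply/row_freeP | apply/row_fullP]; exists A'.
Qed.

Lemma invertible_ex m n (A : 'M[K]_(n, m)) : row_free A && row_full A ->
  exists A' : 'M[K]_(m, n), A *m A' = 1%:M /\ A' *m A = 1%:M.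
Proof.
case/andP => /row_freeP [A1 h1] /row_fullP [A2 h2]; exists A1; split => //.
by rewrite -[A1]mul1mx -h2 -[A2 *m _ *m A1]mulmxA h1 mulmx1.
Qed.

Lemma vhom_dim m n (f : vhom m n) : m = n.
Proof. by case: f => A /= /andP[/eqP rA /eqP <-]; rewrite rA. Qed.

Lemma vhom_unitmx n (f : vhom n n) : vmx f \in unitmx.
Proof. by rewrite -row_free_unit; case/andP: (vmxP f). Qed.

Lemma vid_subproof n : row_free (1%:M : 'M[K]_n) && row_full (1%:M : 'M[K]_n).
Proof. by apply: (@invertibleP n n 1%:M 1%:M); rewrite mulmx1. Qed.

Definition vid n : vhom n n := VHom (vid_subproof n).

Lemma vcomp_subproof a b c (g : vhom b c) (f : vhom a b) :
  row_free (vmx g *m vmx f) && row_full (vmx g *m vmx f).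
Proof.
have [g' [g1 g2]] := invertible_ex (vmxP g).
have [f' [f1 f2]] := invertible_ex (vmxP f).
apply: (@invertibleP _ _ _ (f' *m g')).
  by rewrite mulmxA -(mulmxA (vmx g)) f1 mulmx1.
by rewrite mulmxA -(mulmxA f') g2 mulmx1.
Qed.

Definition vcomp a b c (g : vhom b c) (f : vhom a b) : vhom a c :=
  VHom (vcomp_subproof g f).

Lemma vcomp1m a b (f : vhom a b) : vcomp (vid b) f = f.
Proof. by apply: val_inj; rewrite /= mul1mx. Qed.

Lemma vcompm1 a b (f : vhom a b) : vcomp f (vid a) = f.
Proof. by apply: val_inj; rewrite /= mulmx1. Qed.

Lemma vcompA a b c d (h : vhom c d) (g : vhom b c) (f : vhom a b) :
  vcomp h (vcomp g f) = vcomp (vcomp h g) f.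
Proof. by apply: val_inj; rewrite /= mulmxA. Qed.

Definition Vcat : cat := Cat vcomp1m vcompm1 vcompA.

Lemma vadd_subproof a a' b b' (f : vhom a a') (g : vhom b b') :
  let h := block_mx (vmx f) 0 0 (vmx g) : 'M[K]_(a' + b', a + b) in
  row_free h && row_full h.
Proof.
have [g' [g1 g2]] := invertible_ex (vmxP g).
have [f' [f1 f2]] := invertible_ex (vmxP f).
apply: (@invertibleP _ _ _ (block_mx f' 0 0 g')); rewrite mulmx_block.
  by rewrite !mulmx0 !mul0mx !addr0 !add0r f1 g1 -scalar_mx_block.
by rewrite !mulmx0 !mul0mx !addr0 !add0r f2 g2 -scalar_mx_block.
Qed.

Definition vadd a a' b b' (f : vhom a a') (g : vhom b b') :
  vhom (a + b)%N (a' + b')%N := VHom (vadd_subproof f g).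

Lemma tensmx1 m n : (1%:M : 'M[K]_m) *t (1%:M : 'M[K]_n) = 1%:M.
Proof.
apply/matrixP => i j.
case: (mxtens_indexP i) => i1 i2; case: (mxtens_indexP j) => j1 j2.
rewrite tensmxE !mxE (can_eq (@mxtens_indexK _ _)) xpair_eqE.
by case: eqP => _; case: eqP => _; rewrite ?mul1r ?mul0r.
Qed.

Lemma vmul_subproof a a' b b' (f : vhom a a') (g : vhom b b') :
  let h := vmx f *t vmx g in row_free h && row_full h.
Proof.
have [g' [g1 g2]] := invertible_ex (vmxP g).
have [f' [f1 f2]] := invertible_ex (vmxP f).
by apply: (@invertibleP _ _ _ (f' *t g')); rewrite tensmx_mul ?f1 ?g1 ?f2 ?g2 tensmx1.
Qed.

(* The Kronecker product *t orders the pairs (i, j) lexicographically. *)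
Definition vmul a a' b b' (f : vhom a a') (g : vhom b b') :
  vhom (a * b)%N (a' * b')%N := VHom (vmul_subproof f g).

Lemma vtwa_subproof a b :
  let h := block_mx 0 1%:M 1%:M 0 : 'M[K]_(b + a, a + b) in
  row_free h && row_full h.
Proof.
by apply: (@invertibleP _ _ _ (block_mx 0 1%:M 1%:M 0)); rewrite mulmx_block;
  rewrite !mulmx0 !mul0mx !addr0 !add0r !mulmx1 -scalar_mx_block.
Qed.

Definition vtwa a b : vhom (a + b)%N (b + a)%N := VHom (vtwa_subproof a b).

(* Sends the basis vector e_i (x) e_j to e_j (x) e_i. *)
Definition vtwm_mx a b : 'M[K]_(b * a, a * b) :=
  \matrix_(p, q) (let: (j', i') := mxtens_unindex p in
                  let: (i, j) := mxtens_unindex q in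
                  ((i' == i) && (j' == j))%:R).

Lemma vtwm_mxE a b j' i' i j :
  vtwm_mx a b (mxtens_index (j', i')) (mxtens_index (i, j)) =
  ((i' == i) && (j' == j))%:R.
Proof. by rewrite mxE !mxtens_indexK. Qed.

Lemma sum_mxtens m n (F : 'I_(m * n) -> K) :
  \sum_k F k = \sum_i \sum_j F (mxtens_index (i, j)).
Proof.
rewrite pair_big /= (reindex (@mxtens_index m n)) /=; last first.
  exists (@mxtens_unindex m n) => x _; first exact: mxtens_indexK.
  exact: mxtens_unindexK.
by apply: eq_bigr => -[].
Qed.

Lemma vtwm_conj a a' b b' (f : 'M[K]_(a', a)) (g : 'M[K]_(b', b)) :
  vtwm_mx a' b' *m (f *t g) = (g *t f) *m vtwm_mx a b.
Proof.
apply/matrixP => p q; case: (mxtens_indexP p) => j' i'.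
case: (mxtens_indexP q) => i j; rewrite !mxE !sum_mxtens.
transitivity (f i' i * g j' j).
  rewrite (bigD1 i') //= (bigD1 j') //= !big1 ?addr0.
  - by rewrite vtwm_mxE !eqxx mul1r tensmxE.
  - move=> k nk; rewrite big1 // => l _.
    by rewrite vtwm_mxE eq_sym (negPf nk) mul0r.
  - by move=> l nl; rewrite vtwm_mxE andbC eq_sym (negPf nl) mul0r.
rewrite (bigD1 j) //= (bigD1 i) //= !big1 ?addr0.
- by rewrite vtwm_mxE !eqxx mulr1 tensmxE mulrC.
- move=> k nk; rewrite big1 // => l _.
  by rewrite vtwm_mxE andbC (negPf nk) mulr0.
- by move=> l nl; rewrite vtwm_mxE (negPf nl) mulr0.
Qed.

Lemma vtwmK a b : vtwm_mx b a *m vtwm_mx a b = 1%:M.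
Proof.
apply/matrixP => p q; case: (mxtens_indexP p) => i' j'.
case: (mxtens_indexP q) => i j; rewrite !mxE !sum_mxtens.
rewrite (bigD1 j') //= (bigD1 i') //= !big1 ?addr0.
- rewrite !vtwm_mxE !eqxx mul1r (can_eq (@mxtens_indexK _ _)) xpair_eqE.
  by [].
- move=> k nk; rewrite big1 // => l _.
  by rewrite vtwm_mxE eq_sym (negPf nk) mul0r.
- by move=> l nl; rewrite vtwm_mxE andbC eq_sym (negPf nl) mul0r.
Qed.

Lemma vtwm_subproof a b : row_free (vtwm_mx a b) && row_full (vtwm_mx a b).
Proof. by apply: (@invertibleP _ _ _ (vtwm_mx b a)); rewrite vtwmK. Qed.

Definition vtwm a b : vhom (a * b)%N (b * a)%N := VHom (vtwm_subproof a b).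

Lemma vadd1 a b : vadd (vid a) (vid b) = vid (a + b).
Proof. by apply: val_inj; rewrite /= -scalar_mx_block. Qed.

Lemma vadd_comp a a' a'' b b' b'' (f' : vhom a' a'') (f : vhom a a')
    (g' : vhom b' b'') (g : vhom b b') :
  vadd (vcomp f' f) (vcomp g' g) = vcomp (vadd f' g') (vadd f g).
Proof.
apply: val_inj; rewrite /= mulmx_block.
by rewrite !mulmx0 !mul0mx !addr0 !add0r.
Qed.

Lemma vmul1 a b : vmul (vid a) (vid b) = vid (a * b).
Proof. by apply: val_inj; rewrite /= tensmx1. Qed.

Lemma vmul_comp a a' a'' b b' b'' (f' : vhom a' a'') (f : vhom a a')
    (g' : vhom b' b'') (g : vhom b b') :
  vmul (vcomp f' f) (vcomp g' g) = vcomp (vmul f' g') (vmul f g).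
Proof. by apply: val_inj; rewrite /= tensmx_mul. Qed.

Lemma vtwaK a b : vcomp (vtwa b a) (vtwa a b) = vid (a + b).
Proof.
apply: val_inj; rewrite /= mulmx_block.
by rewrite !mulmx0 !mul0mx !addr0 !add0r !mulmx1 -scalar_mx_block.
Qed.

Lemma vtwmcK a b : vcomp (vtwm b a) (vtwm a b) = vid (a * b).
Proof. by apply: val_inj; rewrite /= vtwmK. Qed.

Definition V : bipermData :=
  @BipermData Vcat 0%N 1%N addn muln vadd vmul addnA add0n addn0
    mulnA mul1n muln1 mul0n muln0 mulnDl vtwa vtwm
    vadd1 vadd_comp vmul1 vmul_comp vtwaK vtwmcK.

End CategoryV.

Section CategoryL.
Variable K : fieldType.

(* The ring Z x K^*. *)
Record larr := LArr { lpair : int * K; larrP : lpair.2 != 0 }.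

HB.instance Definition _ := [isSub for lpair].
HB.instance Definition _ := [Choice of larr by <:].

Definition ldeg (x : larr) : int := (lpair x).1.
Definition lsc (x : larr) : K := (lpair x).2.

Lemma lsc_neq0 x : lsc x != 0. Proof. exact: larrP. Qed.

Lemma larr_eq x y : ldeg x = ldeg y -> lsc x = lsc y -> x = y.
Proof.
by case: x y => -[a b] p [[c d] q]; rewrite /ldeg /lsc /= => ? ?;
  apply: val_inj; congr pair.
Qed.

Definition lmk (n : int) (a : K) (a_neq0 : a != 0) : larr :=
  @LArr (n, a) a_neq0.

Lemma ladd_subproof x y : lsc x * lsc y != 0.
Proof. by rewrite mulf_neq0 ?lsc_neq0. Qed.
Lemma lopp_subproof x : (lsc x)^-1 != 0.
Proof. by rewrite invr_neq0 ?lsc_neq0. Qed.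
Lemma lmul_subproof x y : lsc x ^ ldeg y * lsc y ^ ldeg x != 0.
Proof. by rewrite mulf_neq0 ?expfz_neq0 ?lsc_neq0. Qed.

Definition lzero := lmk 0 (oner_neq0 K).
Definition lone := lmk 1 (oner_neq0 K).
Definition ladd x y := lmk (ldeg x + ldeg y) (ladd_subproof x y).
Definition lopp x := lmk (- ldeg x) (lopp_subproof x).
Definition lmul x y := lmk (ldeg x * ldeg y) (lmul_subproof x y).

Lemma laddA : associative ladd.
Proof. by move=> x y z; apply: larr_eq; rewrite /ldeg /lsc /= ?addrA ?mulrA. Qed.
Lemma laddC : commutative ladd.
Proof. by move=> x y; apply: larr_eq; [exact: addrC | exact: mulrC]. Qed.
Lemma ladd0 : left_id lzero ladd.
Proof. by move=> x; apply: larr_eq; [exact: add0r | exact: mul1r]. Qed.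
Lemma laddN : left_inverse lzero lopp ladd.
Proof.
move=> x; apply: larr_eq; first exact: addNr.
by apply: mulVf; apply: lsc_neq0.
Qed.

HB.instance Definition _ := GRing.isZmodule.Build larr laddA laddC ladd0 laddN.

Lemma lscD x y : lsc (ladd x y) = lsc x * lsc y. Proof. by []. Qed.
Lemma ldegD x y : ldeg (ladd x y) = ldeg x + ldeg y. Proof. by []. Qed.
Lemma lscM x y : lsc (lmul x y) = lsc x ^ ldeg y * lsc y ^ ldeg x.
Proof. by []. Qed.
Lemma ldegM x y : ldeg (lmul x y) = ldeg x * ldeg y. Proof. by []. Qed.

Lemma lmulA : associative lmul.
Proof.
move=> x y z; apply: larr_eq; first exact: mulrA.
rewrite !lscM !ldegM !expfzMl !exprz_exp mulrA; congr (_ * _ ^ _ * _ ^ _).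
  exact: mulrC.
exact: mulrC.
Qed.
Lemma lmulC : commutative lmul.
Proof. by move=> x y; apply: larr_eq; [exact: mulrC | exact: mulrC]. Qed.
Lemma lmul1 : left_id lone lmul.
Proof.
move=> x; apply: larr_eq; first exact: mul1r.
by rewrite lscM exp1rz mul1r expr1z.
Qed.
Lemma lmulDl : left_distributive lmul ladd.
Proof.
move=> x y z; apply: larr_eq; first exact: mulrDl.
by rewrite !(lscM, lscD, ldegD) expfzDr ?lsc_neq0 // expfzMl mulrACA.
Qed.
Lemma lone_neq0 : lone != 0. Proof. by []. Qed.

HB.instance Definition _ :=
  GRing.Zmodule_isComNzRing.Build larr lmulA lmulC lmul1 lmulDl lone_neq0.

(* The morphisms C_m -> C_n: there are none unless m = n, and those from C_n to
   itself are the pairs (n, a) with a in K^*. *)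
Record lhom (m n : int) := LHom {
  larr_of :> larr;
  lhomP : (ldeg larr_of == m) && (ldeg larr_of == n) }.

HB.instance Definition _ m n := [isSub for @larr_of m n].

Lemma lhom_dom m n (f : lhom m n) : ldeg f = m.
Proof. by case/andP: (lhomP f) => /eqP. Qed.
Lemma lhom_cod m n (f : lhom m n) : ldeg f = n.
Proof. by case/andP: (lhomP f) => _ /eqP. Qed.
Lemma lhom_eq m n (f g : lhom m n) : lsc f = lsc g -> f = g.
Proof. by move=> e; apply/val_inj/larr_eq; rewrite // !lhom_dom. Qed.

Lemma lhom_subproof m n (f : larr) : ldeg f = m -> m = n ->
  (ldeg f == m) && (ldeg f == n).
Proof. by move=> -> ->; rewrite eqxx. Qed.

Definition lid n : lhom n n :=
  LHom (@lhom_subproof n n (lmk n (oner_neq0 K)) erefl erefl).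

Lemma lhom_src_tgt a b (f : lhom a b) : a = b.
Proof. by rewrite -(lhom_dom f) lhom_cod. Qed.

(* Composition is the multiplication of K^*. *)
Definition lcomp a b c (g : lhom b c) (f : lhom a b) : lhom a c :=
  LHom (@lhom_subproof a c (lmk a (ladd_subproof g f)) erefl
    (etrans (lhom_src_tgt f) (lhom_src_tgt g))).

Lemma lcomp1m a b (f : lhom a b) : lcomp (lid b) f = f.
Proof. by apply: lhom_eq; rewrite /lsc /= mul1r. Qed.
Lemma lcompm1 a b (f : lhom a b) : lcomp f (lid a) = f.
Proof. by apply: lhom_eq; rewrite /lsc /= mulr1. Qed.
Lemma lcompA a b c d (h : lhom c d) (g : lhom b c) (f : lhom a b) :
  lcomp h (lcomp g f) = lcomp (lcomp h g) f.
Proof. by apply: lhom_eq; rewrite /lsc /= mulrA. Qed.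

Definition Lcat : cat := Cat lcomp1m lcompm1 lcompA.

Lemma laddh_subproof a a' b b' (f : lhom a a') (g : lhom b b') :
  (ldeg (larr_of f + larr_of g) == a + b) &&
  (ldeg (larr_of f + larr_of g) == a' + b').
Proof.
by apply/andP; split; apply/eqP; congr (_ + _);
  do ?[exact: lhom_dom | exact: lhom_cod].
Qed.

Definition laddh a a' b b' (f : lhom a a') (g : lhom b b') :
  lhom (a + b) (a' + b') := LHom (laddh_subproof f g).

Lemma lmulh_subproof a a' b b' (f : lhom a a') (g : lhom b b') :
  (ldeg (larr_of f * larr_of g) == a * b) &&
  (ldeg (larr_of f * larr_of g) == a' * b').
Proof.
by apply/andP; split; apply/eqP; congr (_ * _);
  do ?[exact: lhom_dom | exact: lhom_cod].
Qed.

Definition lmulh a a' b b' (f : lhom a a') (g : lhom b b') :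
  lhom (a * b) (a' * b') := LHom (lmulh_subproof f g).

Lemma lsign_neq0 (z : int) : (-1 : K) ^ z != 0.
Proof. by rewrite expfz_neq0 // oppr_eq0 oner_neq0. Qed.

Definition ltwa (n m : int) : lhom (n + m) (m + n) :=
  LHom (@lhom_subproof (n + m) (m + n) (lmk (n + m) (lsign_neq0 (n * m)))
    erefl (addrC n m)).

(* The division by 4 is exact. *)
Definition ltwm (n m : int) : lhom (n * m) (m * n) :=
  LHom (@lhom_subproof (n * m) (m * n)
    (lmk (n * m) (lsign_neq0 (n * (n - 1) * m * (m - 1) %/ 4)%Z))
    erefl (mulrC n m)).

Lemma laddh1 a b : laddh (lid a) (lid b) = lid (a + b).
Proof. by apply: lhom_eq; exact: mulr1. Qed.

Lemma laddh_comp a a' a'' b b' b'' (f' : lhom a' a'') (f : lhom a a')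
    (g' : lhom b' b'') (g : lhom b b') :
  laddh (lcomp f' f) (lcomp g' g) = lcomp (laddh f' g') (laddh f g).
Proof. by apply: lhom_eq; exact: mulrACA. Qed.

Lemma lmulh1 a b : lmulh (lid a) (lid b) = lid (a * b).
Proof. by apply: lhom_eq; rewrite [LHS]lscM !exp1rz mulr1. Qed.

Lemma lmulh_comp a a' a'' b b' b'' (f' : lhom a' a'') (f : lhom a a')
    (g' : lhom b' b'') (g : lhom b b') :
  lmulh (lcomp f' f) (lcomp g' g) = lcomp (lmulh f' g') (lmulh f g).
Proof.
have ea := lhom_src_tgt f; have eb := lhom_src_tgt g; subst a' b'.
apply: lhom_eq; rewrite [LHS]lscM [RHS]lscD ![lsc (lmulh _ _)]lscM.
by rewrite ![lsc (lcomp _ _)]lscD !lhom_dom !expfzMl mulrACA.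
Qed.

Lemma lsignK (z : int) : (-1 : K) ^ z * (-1) ^ z = 1.
Proof. by rewrite -expfzMl mulrNN mulr1 exp1rz. Qed.

Lemma ltwaK a b : lcomp (ltwa b a) (ltwa a b) = lid (a + b).
Proof.
by apply: lhom_eq; rewrite [LHS]lscD /lsc /= [b * a]mulrC lsignK.
Qed.

Lemma ltwmK a b : lcomp (ltwm b a) (ltwm a b) = lid (a * b).
Proof.
apply: lhom_eq; rewrite [LHS]lscD /lsc /=.
have -> : b * (b - 1) * a * (a - 1) = a * (a - 1) * b * (b - 1).
  by ring.
exact: lsignK.
Qed.

Definition L : bipermData :=
  @BipermData Lcat 0 1 +%R *%R laddh lmulh (@addrA int) (@add0r int) (@addr0 int)
    (@mulrA int) (@mul1r int) (@mulr1 int) (@mul0r int) (@mulr0 int)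
    (@mulrDl int) ltwa ltwm laddh1 laddh_comp lmulh1 lmulh_comp ltwaK ltwmK.

(* (L, (x)), whose associativity isomorphisms are identities. *)
Definition Lmul : monData :=
  @MonData Lcat 1 *%R lmulh (fun a b c : int => @idto Lcat _ _ (esym (mulrA a b c))).

End CategoryL.

Section Determinant.
Variable K : fieldType.

Lemma lsc_add (x y : larr K) : lsc (x + y) = lsc x * lsc y.
Proof. by []. Qed.
Lemma lsc_mul (x y : larr K) : lsc (x * y) = lsc x ^ ldeg y * lsc y ^ ldeg x.
Proof. by []. Qed.
Lemma ldeg_add (x y : larr K) : ldeg (x + y) = ldeg x + ldeg y.
Proof. by []. Qed.
Lemma ldeg_mul (x y : larr K) : ldeg (x * y) = ldeg x * ldeg y.
Proof. by []. Qed.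
Lemma lsc_comp a b c (g : lhom K b c) (f : lhom K a b) :
  lsc (lcomp g f) = lsc g * lsc f.
Proof. by []. Qed.

Lemma ldeg_zmod : zmod_morphism (@ldeg K). Proof. by []. Qed.
Lemma ldeg_monoid : monoid_morphism (@ldeg K). Proof. by []. Qed.
HB.instance Definition _ := GRing.isZmodMorphism.Build _ _ (@ldeg K) ldeg_zmod.
HB.instance Definition _ := GRing.isMonoidMorphism.Build _ _ (@ldeg K) ldeg_monoid.

Definition lint (n : int) : larr K := lmk n (oner_neq0 K).
Lemma lint_zmod : zmod_morphism lint.
Proof. by move=> x y; apply: larr_eq; rewrite // [RHS]mul1r /lsc /= invr1. Qed.
Lemma lint_monoid : monoid_morphism lint.
Proof. by split=> // x y; apply: larr_eq; rewrite // [RHS]lscM !exp1rz mulr1. Qed.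
HB.instance Definition _ := GRing.isZmodMorphism.Build _ _ lint lint_zmod.
HB.instance Definition _ := GRing.isMonoidMorphism.Build _ _ lint lint_monoid.

Variable n : nat.

Definition detL_ob (E : Mat (L K) n) : Lmul K :=
  \det (\matrix_(i, j) (E i j : int)).

(* A morphism of M_n(L), as a matrix with entries in the ring Z x K^*. *)
Definition larr_mx (E F : Mat (L K) n) (f : hom E F) : 'M[larr K]_n :=
  \matrix_(i, j) larr_of (f i j : lhom K _ _).

Lemma detL_subproof (E F : Mat (L K) n) (f : hom E F) :
  (ldeg (\det (larr_mx f)) == detL_ob E) && (ldeg (\det (larr_mx f)) == detL_ob F).
Proof.
rewrite -det_map_mx; apply/andP; split; apply/eqP; congr (\det _);
  apply/matrixP => i j; rewrite !mxE; [exact: lhom_dom | exact: lhom_cod].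
Qed.

Definition detL_hom (E F : Mat (L K) n) (f : hom E F) :
  lhom K (detL_ob E) (detL_ob F) := LHom (detL_subproof f).

Lemma detL_id E : detL_hom (idm E) = idm (detL_ob E).
Proof.
apply: lhom_eq; rewrite /= (_ : larr_mx _ = map_mx lint (\matrix_(i, j) E i j)).
  by rewrite det_map_mx.
by apply/matrixP => i j; rewrite !mxE; apply: larr_eq.
Qed.

Let lcompR (x y z : larr K) :=
  [/\ ldeg x = ldeg z, ldeg y = ldeg z & lsc z = lsc x * lsc y].

Let lcompR_D x y z x' y' z' : lcompR x y z -> lcompR x' y' z' ->
  lcompR (x + x') (y + y') (z + z').
Proof.
move=> [a b c] [a' b' c']; split; rewrite ?ldeg_add ?a ?b ?a' ?b' //.
by rewrite !lsc_add c c' mulrACA.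
Qed.

Let lcompR_M x y z x' y' z' : lcompR x y z -> lcompR x' y' z' ->
  lcompR (x * x') (y * y') (z * z').
Proof.
move=> [a b c] [a' b' c']; split; rewrite ?ldeg_mul ?a ?b ?a' ?b' //.
by rewrite !lsc_mul c c' a b a' b' !expfzMl mulrACA.
Qed.

Lemma detL_comp E F G (g : hom F G) (f : hom E F) :
  detL_hom (g \c f) = (detL_hom g : @hom (Lcat K) _ _) \c detL_hom f.
Proof.
apply: lhom_eq; rewrite /=.
suff [_ _ ->] : lcompR (\det (larr_mx g)) (\det (larr_mx f))
                  (\det (larr_mx (g \c f))) by [].
rewrite /determinant.
elim/big_rec3: _ => [|s x y z _ IH]; first by split; rewrite // [RHS]mulr1.
apply: lcompR_D => //; apply: lcompR_M.
  have -> : (-1 : larr K) ^+ (perm.odd_perm s) = lint ((-1) ^+ (perm.odd_perm s)).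
    by rewrite rmorphXn rmorphN1.
  by split=> //; rewrite [RHS]mulr1.
elim/big_rec3: _ => [|i {IH x y z}x y z _ IH].
  by split=> //; rewrite [RHS]mulr1.
apply: lcompR_M => //; rewrite !mxE; split.
- by rewrite !lhom_cod.
- by rewrite !lhom_dom.
- by [].
Qed.

Lemma osumE m (f : 'I_m -> L K) : osum f = \sum_i (f i : int).
Proof. by elim: m f => [|m IH] f /=; rewrite ?big_ord0 // big_ord_recl -IH. Qed.

Lemma hsumE m (a b : 'I_m -> L K) (f : forall i, hom (a i) (b i)) :
  larr_of (hsum f : lhom K _ _) = \sum_i larr_of (f i : lhom K _ _).
Proof.
elim: m a b f => [|m IH] a b f /=; first by rewrite big_ord0; apply: larr_eq.
by rewrite big_ord_recl -IH.
Qed.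

Lemma idto_lsc (a b : Lcat K) (e : a = b) : lsc (idto e : lhom K _ _) = 1.
Proof. by case: b / e. Qed.

Lemma detL_1 : detL_ob tuno = tuno.
Proof.
rewrite /detL_ob (_ : \matrix_(_, _) _ = 1%:M) ?det1 //.
by apply/matrixP => i j; rewrite !mxE /= /mat_one; case: eqP.
Qed.

Lemma detL_M (E F : Mat (L K) n) :
  detL_ob (tens E F) = tens (detL_ob E) (detL_ob F).
Proof.
apply: etrans (det_mulmx _ _); congr (\det _); apply/matrixP => i k.
by rewrite !mxE /= /mat_mul osumE; apply: eq_bigr => j _; rewrite !mxE.
Qed.

Lemma detL_homM (E E' F F' : Mat (L K) n) (f : hom E E') (g : hom F F') :
  idto (detL_M E' F') \c
    (detL_hom (tensh f g) : @hom (Lmul K) _ _) =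
  tensh (m := Lmul K) (detL_hom f) (detL_hom g)
    \c idto (detL_M E F).
Proof.
apply: lhom_eq.
rewrite [LHS]lsc_comp [RHS]lsc_comp !idto_lsc mul1r mulr1.
rewrite [RHS]/(lsc (\det (larr_mx f) * \det (larr_mx g))) -det_mulmx; congr (lsc (\det _)); apply/matrixP => i k.
by rewrite !mxE hsumE; apply: eq_bigr => j _; rewrite !mxE.
Qed.

Definition detL : prodFunctor (Mat (L K) n) (Lmul K) :=
  @ProdFunctor (Mat (L K) n) (Lmul K) detL_ob detL_hom detL_id detL_comp
    detL_1 detL_M detL_homM.

(* The determinant of an isomorphism K^a -> K^b, which forces a = b. *)
Definition vdet (a b : nat) (f : vhom K a b) : K :=
  \det (castmx (esym (vhom_dim f), erefl a) (vmx f)).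

Lemma vdetE a (f : vhom K a a) : vdet f = \det (vmx f).
Proof. by rewrite /vdet castmx_id. Qed.

Lemma vdet_neq0 a b (f : vhom K a b) : vdet f != 0.
Proof.
have e := vhom_dim f; subst b; rewrite vdetE.
by have := vhom_unitmx f; rewrite unitmxE unitfE.
Qed.

Definition Lam_ob (a : V K) : L K := Posz a.

Lemma Lam_subproof a b (f : vhom K a b) : Posz a = Posz b.
Proof. by rewrite (vhom_dim f). Qed.

Definition Lam_hom (a b : V K) (f : hom a b) : hom (Lam_ob a) (Lam_ob b) :=
  LHom (@lhom_subproof K (Posz a) (Posz b) (lmk (Posz a) (vdet_neq0 f)) erefl
          (Lam_subproof f)).

Lemma Lam_id (a : V K) : Lam_hom (idm a) = idm (Lam_ob a).
Proof. by apply: lhom_eq; rewrite /lsc /= vdetE det1. Qed.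

Lemma Lam_comp (a b c : V K) (g : hom b c) (f : hom a b) :
  Lam_hom (g \c f) = Lam_hom g \c Lam_hom f.
Proof.
apply: lhom_eq; rewrite /lsc /= /lsc /=.
have e := vhom_dim g; have e' := vhom_dim f; subst c; subst b.
by rewrite !vdetE det_mulmx.
Qed.

Lemma vdet_add a a' b b' (f : vhom K a a') (g : vhom K b b') :
  vdet (vadd f g) = vdet f * vdet g.
Proof.
have e := vhom_dim g; have e' := vhom_dim f; subst a' b'.
by rewrite !vdetE det_ublock.
Qed.

Lemma det_tens1mx a b (g : 'M[K]_b) :
  \det ((1%:M : 'M[K]_a) *t g) = \det g ^+ a.
Proof.
elim: a => [|a IH]; first by rewrite det_mx00.
have -> : (1%:M : 'M[K]_(1 + a)) *t g =
    block_mx g 0 0 ((1%:M : 'M[K]_a) *t g) :> 'M_(b + a * b).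
  apply/matrixP => p q.
  case: (mxtens_indexP (p : 'I_((1 + a) * b))) => i j.
  case: (mxtens_indexP (q : 'I_((1 + a) * b))) => i' j'.
  apply: (etrans (tensmxE (1%:M : 'M[K]_(1 + a)) g i j i' j')).
  have idx0 (k : 'I_b) (z : 'I_1):
      mxtens_index (lshift a z, k) = lshift (a * b) k :> 'I_(b + a * b).
    by apply: val_inj; rewrite /= ord1 mul0n.
  have idx1 (k : 'I_b) (z : 'I_a) :
      mxtens_index (rshift 1 z, k) = rshift b (mxtens_index (z, k)) :> 'I_(b + a * b).
    by apply: val_inj; rewrite /= mulSn addnA.
  rewrite -(splitK i) -(splitK i').
  case: (split i) => u; case: (split i') => u'; rewrite /= ?idx0 ?idx1.
  - by rewrite block_mxEul !ord1 mxE eqxx mul1r.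
  - by rewrite block_mxEur !mxE eq_lrshift mul0r.
  - by rewrite block_mxEdl !mxE eq_rlshift mul0r.
  - by rewrite block_mxEdr tensmxE !mxE eq_rshift.
by rewrite (@det_ublock _ b (a * b)) IH exprS.
Qed.

Lemma det_conj p q (e : p = q) (T : 'M[K]_(q, p)) (S : 'M[K]_(p, q))
    (X : 'M[K]_p) (Y : 'M[K]_q) :
  S *m T = 1%:M -> T *m X = Y *m T -> \det X = \det Y.
Proof.
subst q => ST TX.
have dT : \det T != 0.
  apply/eqP => T0; have := congr1 determinant ST.
  by rewrite det_mulmx T0 mulr0 det1 => /eqP; rewrite eq_sym oner_eq0.
apply: (mulfI dT); rewrite -det_mulmx TX det_mulmx mulrC.
by [].
Qed.

Lemma det_tensmx a b (f : 'M[K]_a) (g : 'M[K]_b) :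
  \det (f *t g) = \det f ^+ b * \det g ^+ a.
Proof.
have -> : f *t g = (f *t 1%:M) *m (1%:M *t g).
  by rewrite tensmx_mul mulmx1 mul1mx.
rewrite det_mulmx det_tens1mx; congr (_ * _).
rewrite -(det_tens1mx b f).
by apply: (det_conj (mulnC a b) (vtwmK K a b)); apply: vtwm_conj.
Qed.

Lemma vdet_mul a a' b b' (f : vhom K a a') (g : vhom K b b') :
  vdet (vmul f g) = vdet f ^+ b * vdet g ^+ a.
Proof.
have e := vhom_dim g; have e' := vhom_dim f; subst a' b'.
by rewrite !vdetE det_tensmx.
Qed.

Lemma Lam_osum m (f : 'I_m -> V K) :
  Lam_ob (osum f) = osum (fun i => Lam_ob (f i)).
Proof. by elim: m f => //= m IH f; rewrite /= -IH /Lam_ob PoszD. Qed.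

Lemma Lam_hsum m (a b : 'I_m -> V K) (f : forall i, hom (a i) (b i)) :
  larr_of (Lam_hom (hsum f) : lhom K _ _) =
  \sum_i larr_of (Lam_hom (f i) : lhom K _ _).
Proof.
elim: m a b f => [|m IH] a b f.
  by rewrite big_ord0; apply: larr_eq; rewrite // /lsc /= vdetE det_mx00.
rewrite big_ord_recl -IH; apply: larr_eq; rewrite //.
by rewrite [RHS]lscD /lsc /= vdet_add.
Qed.

Definition LamM_ob (E : Mat (V K) n) : Mat (L K) n := fun i j => Lam_ob (E i j).

Definition LamM_hom (E F : Mat (V K) n) (f : hom E F) :
  hom (LamM_ob E) (LamM_ob F) := fun i j => Lam_hom (f i j).

Lemma LamM_id E : LamM_hom (idm E) = idm (LamM_ob E).
Proof.
by apply: functional_extensionality_dep => i;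
   apply: functional_extensionality_dep => j; exact: Lam_id.
Qed.

Lemma LamM_comp E F G (g : hom F G) (f : hom E F) :
  LamM_hom (g \c f) = LamM_hom g \c LamM_hom f.
Proof.
by apply: functional_extensionality_dep => i;
   apply: functional_extensionality_dep => j; exact: Lam_comp.
Qed.

Lemma LamM_1 : LamM_ob tuno = tuno.
Proof.
apply: functional_extensionality_dep => i.
apply: functional_extensionality_dep => j.
by rewrite /LamM_ob /= /mat_one; case: eqP.
Qed.

Lemma LamM_M (E F : Mat (V K) n) :
  LamM_ob (tens E F) = tens (LamM_ob E) (LamM_ob F).
Proof.
apply: functional_extensionality_dep => i.
apply: functional_extensionality_dep => k.
by rewrite /LamM_ob /= /mat_mul Lam_osum.
Qed.

Lemma idto_mat (B : bipermData) (E F : Mat B n) (e : E = F) i j :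
  idto e i j = idto (f_equal (fun G : Mat B n => G i j) e).
Proof. by case: F / e. Qed.

Lemma LamM_homM (E E' F F' : Mat (V K) n) (f : hom E E') (g : hom F F') :
  idto (LamM_M E' F') \c LamM_hom (tensh f g) =
  tensh (LamM_hom f) (LamM_hom g) \c idto (LamM_M E F).
Proof.
apply: functional_extensionality_dep => i.
apply: functional_extensionality_dep => k.
apply: lhom_eq.
rewrite [LHS]lsc_comp [RHS]lsc_comp !idto_mat !idto_lsc mul1r mulr1.
congr lsc; apply: (etrans (@Lam_hsum n _ _ (fun j => mulh (f i j) (g j k)))).
apply/esym/(etrans (@hsumE n _ _ (fun j => mulh (Lam_hom (f i j)) (Lam_hom (g j k))))).
apply/esym.
apply: eq_bigr => j _; apply: larr_eq; first by rewrite /ldeg /= PoszM.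
by rewrite [RHS]lscM {1}/lsc /= vdet_mul.
Qed.

Definition LamM : prodFunctor (Mat (V K) n) (Mat (L K) n) :=
  ProdFunctor LamM_id LamM_comp LamM_1 LamM_homM.

Definition DetV : prodFunctor (Mat (V K) n) (Lmul K) := compF detL LamM.

End Determinant.

Definition arrow (K : fieldType) (a b : Lmul K) (f : hom a b) : int * K :=
  lpair (larr_of f).

Section WeaklyInvertible.
Variables (K : fieldType) (M : monData) (D : prodFunctor M (Lmul K)).

Definition weakly_invertible : pred M :=
  fun E => ((D E : int) == 1) || ((D E : int) == -1).

Lemma weakly_invertible1 : weakly_invertible tuno.
Proof. by rewrite /weakly_invertible fob1 eqxx. Qed.

Lemma weakly_invertibleM E F : weakly_invertible E -> weakly_invertible F ->
  weakly_invertible (tens E F).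
Proof.
rewrite /weakly_invertible fobM /=.
by case/orP => /eqP -> /orP [] /eqP ->.
Qed.

Definition Gl : monData := fullsub weakly_invertible1 weakly_invertibleM.

Definition restrict_Gl : prodFunctor Gl (Lmul K) :=
  compF D (incl weakly_invertible1 weakly_invertibleM).

End WeaklyInvertible.

(* Main.v *)
Require Import Defs.
From HB Require Import structures.
From mathcomp Require Import all_boot all_order all_algebra perm.
From mathcomp Require Import zify ring.
From mathcomp Require Import complex mxtens reals.

(** Both functors send the associativity isomorphism of E, F, G to the
    determinant, over the ring Z x K^*, of a matrix M whose entry (i, l) is
    (a_il, s_il): here a = E F G is the product of the integer matrices of
    dimensions, and s_il is the determinant of the coherence isomorphism in the
    entry (i, l). For L and for V alike, s_il is a product of signs of twists.
    To treat the two cases at once, [determinant_on] collects what is needed of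
    a determinant on a bipermutative category in order to compute s_il.

    The value is always a sign. Every s_il squares to 1, and squaring the scalar,
    (n, a) |-> (n, a ^ 2), is a ring endomorphism of Z x K^*. It commutes with
    the determinant and maps M to a matrix over the subring Z x 1, so the scalar
    of the determinant of M squares to 1 as well ([lsc_det_sqr]).

    The value -1 occurs. When the entries of E have dimension 0 or 1, left
    distributivity has sign 1, and s_il is the sign of the permutation of the
    summands E_ij F_jk G_kl: the exponent is the sum, over k < k' and j' < j, of
    (E_ij F_jk G_kl) (E_ij' F_j'k' G_k'l) ([lsc_mat_assoc]). Fix two indices
    p < q, let E = G be the elementary matrix 1 + delta_pq and F the
    transposition of p and q. Only row p of E and column q of G have two nonzero
    entries, so s_pq = -1 and all other s_il are 1 ([lsc_assoc_witness]). Rows p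
    and q of a = E F G are equal up to one unit in position (p, q), so a - delta_pq
    is singular. Since the determinant is affine in the entry (p, q), the sign of
    that entry is transferred to det M, raised to the power det a = -1
    ([det_one_sign]). All the objects of E, F, G are 0 or 1 and
    their determinants are 1 and -1, so the same triple serves for V and L, and
    for the weakly invertible matrices.

    The associativity isomorphisms of (L, (x)) are identities, so a value with
    scalar -1 contradicts the hexagon ([monoidal_lsc]). *)

Set Implicit Arguments.
Unset Strict Implicit.
Unset Printing Implicit Defensive.

Import Order.TTheory GRing.Theory Num.Theory.

Local Open Scope ring_scope.
Local Open Scope cat_scope.

Local Notation hom := Defs.hom.

(** * Determinants over the ring Z x K^* *)

Section Scalars.
Variable K : fieldType.

Lemma signzD (x y : int) : (-1 : K) ^ (x + y) = (-1) ^ x * (-1) ^ y.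
Proof. by rewrite expfzDr // oppr_eq0 oner_neq0. Qed.

Lemma lsc_lint z : lsc (lint K z) = 1. Proof. by []. Qed.

Definition lsquare (x : larr K) : larr K :=
  lmk (ldeg x) (expf_neq0 2 (lsc_neq0 x)).

Lemma lsquare_zmod : zmod_morphism lsquare.
Proof.
move=> x y; apply: larr_eq => //.
by rewrite /= [LHS]exprMn exprVn.
Qed.

Lemma lsquare_monoid : monoid_morphism lsquare.
Proof.
split=> [|x y]; apply: larr_eq; rewrite ?[LHS]expr1n //.
rewrite -[LHS]/((lsc x ^ ldeg y * lsc y ^ ldeg x) ^+ 2).
rewrite -[RHS]/((lsc x ^+ 2) ^ ldeg y * (lsc y ^+ 2) ^ ldeg x).
by rewrite exprMn !exprnP !exprz_exp ![_ * 2]mulrC.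
Qed.

HB.instance Definition _ :=
  GRing.isZmodMorphism.Build _ _ lsquare lsquare_zmod.
HB.instance Definition _ :=
  GRing.isMonoidMorphism.Build _ _ lsquare lsquare_monoid.

(** The endomorphism [lsquare] maps such a matrix to the image under [lint] of
    its matrix of degrees, and both ring morphisms commute with determinants. *)
Lemma lsc_det_sqr n (M : 'M[larr K]_n) :
  (forall i j, lsc (M i j) ^+ 2 = 1) -> lsc (\det M) ^+ 2 = 1.
Proof.
move=> M1; rewrite -[LHS]/(lsc (lsquare (\det M))) -det_map_mx.
have -> : map_mx lsquare M = map_mx (@lint K) (map_mx (@ldeg K) M).
  by apply/matrixP => i j; rewrite !mxE; apply: larr_eq => //; exact: M1.
by rewrite det_map_mx.
Qed.

(** The pair (0, -1): adding it changes the sign of a scalar. *)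
Definition leps : larr K := @lmk K 0 (-1) (lsign_neq0 K 1).

(** Row p of M is (1 + leps) times row p of A minus leps times row p of
    A - delta_pq, while the other rows of the three matrices agree; so the
    determinant of M is the same combination of det A and 0. *)
Lemma det_one_sign n (A : 'M[int]_n) (p q : 'I_n) (M : 'M[larr K]_n) :
  \det (A - delta_mx p q) = 0 ->
  (forall i j, M i j = lint K (A i j) + leps *+ ((i == p) && (j == q))) ->
  \det M = (1 + leps) * lint K (\det A).
Proof.
move=> A0 ME.
pose C := map_mx (@lint K) (A - delta_mx p q).
have := @determinant_multilinear _ _ M (map_mx (@lint K) A) C p (1 + leps) (- leps).
rewrite !det_map_mx A0 raddf0 mulr0 addr0; apply.
- apply/rowP => j; rewrite !mxE ME eqxx /= rmorphB /= rmorph_nat.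
  by case: eqP => _ /=; ring.
- by apply/matrixP=> i j; rewrite !mxE ME eq_sym (negPf (neq_lift _ _)) addr0.
- apply/matrixP=> i j; rewrite !mxE ME eq_sym (negPf (neq_lift _ _)).
  by rewrite subr0 addr0.
Qed.

End Scalars.

(** * The sign of the associativity isomorphism *)

(** A degree and a scalar for each morphism, compatible with the direct sum, the
    composition and the symmetries; on V these are the dimension and the
    determinant. The multiplicative twist enters the associativity isomorphism
    only through left distributivity, so that a sign is enough in general, and
    its value is prescribed only when one factor has dimension 0 or 1. *)
Record determinant_on (K : fieldType) (B : bipermData) := DeterminantOn {
  dimo : B -> int;
  deth : forall a b : B, hom a b -> larr K;
  dimo0 : dimo zeroo = 0;
  dimo1 : dimo oneo = 1;
  dimoD : forall a b, dimo (addo a b) = dimo a + dimo b;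
  dimoM : forall a b, dimo (mulo a b) = dimo a * dimo b;
  ldeg_deth : forall a b (f : hom a b), ldeg (deth f) = dimo a;
  deth_id : forall a, deth (idm a) = lint K (dimo a);
  lsc_deth_comp : forall a b c (g : hom b c) (f : hom a b),
    lsc (deth (g \c f)) = lsc (deth g) * lsc (deth f);
  deth_addh : forall a a' b b' (f : hom a a') (g : hom b b'),
    deth (addh f g) = deth f + deth g;
  lsc_twa : forall a b, lsc (deth (twa a b)) = (-1) ^ (dimo a * dimo b);
  lsc_twm_sqr : forall a b, lsc (deth (twm a b)) ^+ 2 = 1;
  lsc_twm01 : forall a b, dimo a = 0 \/ dimo a = 1 -> lsc (deth (twm a b)) = 1 }.

Arguments dimo {K B} d a.
Arguments deth {K B} d {a b} f.

(** The number of crossings of basis vectors, for blocks of sizes u_j and v_j,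
    in the permutation from u_0 + u_1 + ... + v_0 + v_1 + ... to
    u_0 + v_0 + u_1 + v_1 + ...: the block v_j' moves across each u_j with
    j > j'. *)
Definition inversions m (u v : 'I_m -> int) : int :=
  \sum_(j < m) \sum_(j' < m | (j' < j)%N) u j * v j'.

Lemma inversions_recl m (u v : 'I_m.+1 -> int) :
  inversions u v = (\sum_j u (lift ord0 j)) * v ord0 +
    inversions (fun j => u (lift ord0 j)) (fun j => v (lift ord0 j)).
Proof.
rewrite /inversions big_ord_recl big1 ?add0r; last by [].
rewrite mulr_suml -big_split; apply: eq_bigr => j _ /=.
by rewrite big_mkcond big_ord_recl /= -big_mkcond.
Qed.

Lemma inversions_sumr m n (u : 'I_m -> int) (v : 'I_n -> 'I_m -> int) :
  inversions u (fun j => \sum_i v i j) = \sum_i inversions u (v i).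
Proof.
rewrite exchange_big; apply: eq_bigr => j _; rewrite exchange_big.
by apply: eq_bigr => j' _; rewrite mulr_sumr.
Qed.

Section CoherenceSigns.
Variables (K : fieldType) (B : bipermData) (d : determinant_on K B).

Lemma lsc_idto (a b : B) (e : a = b) : lsc (deth d (idto e)) = 1.
Proof. by case: b / e; rewrite deth_id. Qed.

Lemma lsc_id (a : B) : lsc (deth d (idm a)) = 1.
Proof. by rewrite deth_id. Qed.

Lemma lsc_addh (a a' b b' : B) (f : hom a a') (g : hom b b') :
  lsc (deth d (addh f g)) = lsc (deth d f) * lsc (deth d g).
Proof. by rewrite deth_addh. Qed.

Lemma dimo_osum n (f : 'I_n -> B) : dimo d (osum f) = \sum_i dimo d (f i).
Proof.
by elim: n f => [|n IH] f /=; rewrite ?big_ord0 ?dimo0 // big_ord_recl dimoD IH.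
Qed.

Lemma lsc_hsum n (a b : 'I_n -> B) (f : forall i, hom (a i) (b i)) :
  lsc (deth d (hsum f)) = \prod_i lsc (deth d (f i)).
Proof.
elim: n a b f => [|n IH] a b f /=; first by rewrite big_ord0 lsc_id.
by rewrite big_ord_recl lsc_addh IH.
Qed.

(** The two twists are mutually inverse. *)
Lemma lsc_twmV01 (a b : B) :
  dimo d a = 0 \/ dimo d a = 1 -> lsc (deth d (twm b a)) = 1.
Proof.
move=> a01; rewrite -[LHS]mulr1 -[X in _ * X](@lsc_twm01 _ _ d a b a01).
by rewrite -lsc_deth_comp twmK lsc_id.
Qed.

Let lscE := (lsc_deth_comp, lsc_addh, lsc_idto, lsc_id, mulr1, mul1r).

Lemma lsc_ldistV_sqr (a b c : B) : lsc (deth d (ldistV a b c)) ^+ 2 = 1.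
Proof. by rewrite !lscE !exprMn !lsc_twm_sqr !mulr1. Qed.

Lemma lsc_ldistV01 (a b c : B) :
  dimo d a = 0 \/ dimo d a = 1 -> lsc (deth d (ldistV a b c)) = 1.
Proof. by move=> a01; rewrite !lscE lsc_twmV01 // !lsc_twm01 // !mulr1. Qed.

Lemma lsc_ldistVn_sqr n (a : B) (f : 'I_n -> B) :
  lsc (deth d (ldistVn a f)) ^+ 2 = 1.
Proof.
elim: n f => [|n IH] f /=; first by rewrite lscE expr1n.
by rewrite lsc_deth_comp lsc_addh lsc_id mul1r exprMn lsc_ldistV_sqr IH mulr1.
Qed.

Lemma lsc_ldistVn01 n (a : B) (f : 'I_n -> B) :
  dimo d a = 0 \/ dimo d a = 1 -> lsc (deth d (ldistVn a f)) = 1.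
Proof.
move=> a01; elim: n f => [|n IH] f /=; first by rewrite lscE.
by rewrite lsc_deth_comp lsc_addh lsc_id mul1r lsc_ldistV01 // IH mulr1.
Qed.

Lemma lsc_osumD n (f g : 'I_n -> B) :
  lsc (deth d (osumD f g)) =
  (-1) ^ inversions (fun j => dimo d (f j)) (fun j => dimo d (g j)).
Proof.
elim: n f g => [|n IH] f g /=.
  by rewrite lscE /inversions big_ord0 expr0z.
by rewrite !lscE IH inversions_recl signzD lsc_twa dimo_osum mulrC.
Qed.

(** Each step of the recursion merges one more row into the column sums, which
    crosses the later rows; inversions being additive in the second argument,
    this gives one term for each pair of rows. *)
Lemma lsc_osum_swap n m (x : 'I_n -> 'I_m -> B) :
  lsc (deth d (osum_swap x)) =
  (-1) ^ (\sum_(i < n) \sum_(i' < n | (i < i')%N)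
            inversions (fun j => dimo d (x i j)) (fun j => dimo d (x i' j))).
Proof.
elim: n x => [|n IH] x /=; first by rewrite lscE big_ord0 expr0z.
rewrite !lscE IH lsc_osumD big_ord_recl signzD; congr (_ ^ _ * _ ^ _).
  rewrite [RHS]big_mkcond big_ord_recl /= add0r -inversions_sumr.
  by apply: eq_bigr => j _; apply: eq_bigr => j' _; rewrite dimo_osum.
by apply: eq_bigr => i _; rewrite [RHS]big_mkcond big_ord_recl /= add0r -big_mkcond.
Qed.

(** The four factors of the associativity isomorphism are right distributivity
    and reassociation, which are identities, the permutation of the summands, and
    left distributivity, of sign 1 by the hypothesis on the row i of E. *)
Lemma lsc_mat_assoc n (E F G : Mat B n) i l :
  (forall j, dimo d (E i j) = 0 \/ dimo d (E i j) = 1) ->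
  lsc (deth d (assoc E F G i l)) =
  (-1) ^ (\sum_(k < n) \sum_(k' < n | (k < k')%N)
    inversions (fun j => dimo d (E i j) * dimo d (F j k) * dimo d (G k l))
               (fun j => dimo d (E i j) * dimo d (F j k') * dimo d (G k' l))).
Proof.
move=> E01; rewrite !lsc_deth_comp lsc_osum_swap !lsc_hsum.
rewrite [X in X * _ * _ * _]big1 => [|j _]; last by rewrite lsc_ldistVn01.
rewrite [X in _ * X * _ * _]big1 => [|j _]; last first.
  by rewrite lsc_hsum big1 // => k _; rewrite lsc_idto.
rewrite [X in _ * X]big1 => [|k _]; last by rewrite lsc_idto.
rewrite !(mulr1, mul1r); congr (_ ^ _).
apply: eq_bigr => k _; apply: eq_bigr => k' _.
by apply: eq_bigr => j _; apply: eq_bigr => j' _; rewrite !dimoM.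
Qed.

Lemma lsc_mat_assoc_sqr n (E F G : Mat B n) i l :
  lsc (deth d (assoc E F G i l)) ^+ 2 = 1.
Proof.
rewrite !lsc_deth_comp lsc_osum_swap !lsc_hsum !exprMn -!prodrXl.
rewrite [X in X * _ * _ * _]big1 => [|j _]; last by rewrite lsc_ldistVn_sqr.
rewrite [X in _ * X * _ * _]big1 => [|j _]; last first.
  by rewrite lsc_hsum big1 ?expr1n // => k _; rewrite lsc_idto.
rewrite [X in _ * X]big1 => [|k _]; last by rewrite lsc_idto expr1n.
by rewrite !(mulr1, mul1r) expr2 lsignK.
Qed.

End CoherenceSigns.

(** * The determinants on L and on V *)

Lemma lsc_ltwm01 (K : fieldType) (a b : int) :
  a = 0 \/ a = 1 -> lsc (ltwm K a b) = 1.
Proof.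
rewrite -[lsc _]/((-1) ^ (a * (a - 1) * b * (b - 1) %/ 4)%Z).
by case=> ->; rewrite ?subrr ?mulr0 ?mul0r div0z expr0z.
Qed.

Definition determinant_L (K : fieldType) : determinant_on K (L K).
Proof.
apply: (@DeterminantOn K (L K) (fun a => a) (fun a b f => larr_of f)) => //.
- by move=> a b f; exact: lhom_dom.
- by move=> a b; rewrite expr2; exact: lsignK.
- by move=> a b; exact: lsc_ltwm01.
Defined.

Section DeterminantV.
Variable K : fieldType.

(** The additive twist of a and b as a square matrix of size n = a + b. Its size
    is a separate parameter so that the expansion along the first row does not
    require casts. *)
Definition block_twist_mx n a b : 'M[K]_n :=
  \matrix_(i, j) ((i + a == j :> nat)%N || (i == j + b :> nat)%N)%:R.

(** By expansion along the first row, whose only nonzero entry is in column a: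
    the complementary minor is the twist of a and b - 1. *)
Lemma det_block_twist_mx n a b : n = (a + b)%N ->
  \det (block_twist_mx n a b) = (-1) ^+ (a * b).
Proof.
elim: b n => [|b IH] n.
  rewrite addn0 muln0 expr0 => ->; rewrite -[RHS](det1 K a); congr (\det _).
  apply/matrixP => i j; rewrite !mxE addn0; congr ((_ : bool)%:R).
  have := ltn_ord i; have := ltn_ord j.
  by rewrite -[RHS]/((i : nat) == j) => ? ?; lia.
case: n => [|n]; first by lia.
rewrite addnS => -[nE]; rewrite (expand_det_row _ ord0).
have an : (a < n.+1)%N by lia.
rewrite (bigD1 (Ordinal an)) //= big1 ?addr0 => [|j ja]; last first.
  rewrite mxE /= add0n; move: ja; rewrite -val_eqE /= eq_sym => /negPf ->.
  by rewrite addnS mul0r.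
rewrite mxE /= eqxx mul1r /cofactor add0n mulnS exprD; congr (_ * _).
rewrite -(IH n nE); congr (\det _); apply/matrixP => i j.
rewrite !mxE /=; congr ((_ : bool)%:R).
have := ltn_ord i; have := ltn_ord j; rewrite /= /bump /= => ? ?.
case: leqP => ? /=; lia.
Qed.

Lemma vdet_vtwa a b : vdet (vtwa K a b) = (-1) ^+ (a * b).
Proof.
rewrite /vdet -(@det_block_twist_mx _ a b erefl); congr (\det _).
apply/matrixP => i j; rewrite castmxE !mxE.
case: splitP => k /= ik; rewrite mxE; case: splitP => l /= jl; rewrite mxE;
  have := ltn_ord k; have := ltn_ord l => ? ?; rewrite ik jl.
- by rewrite (_ : _ || _ = false) //; lia.
- by rewrite -val_eqE; congr (nat_of_bool _)%:R; rewrite /=; lia.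
- by rewrite -val_eqE; congr (nat_of_bool _)%:R; rewrite /=; lia.
- by rewrite (_ : _ || _ = false) //; lia.
Qed.

Lemma vdet_sqr_orthogonal a b (f : vhom K a b) :
  (vmx f)^T *m vmx f = 1%:M -> vdet f ^+ 2 = 1.
Proof.
have e := vhom_dim f; subst b; rewrite vdetE => ff.
by rewrite expr2 -{1}det_tr -det_mulmx ff det1.
Qed.

Lemma vtwm_mxT a b : (vtwm_mx K a b)^T = vtwm_mx K b a.
Proof.
apply/matrixP => p q; rewrite mxE.
case: (mxtens_indexP p) => i j; case: (mxtens_indexP q) => j' i'.
by rewrite !vtwm_mxE andbC; congr (nat_of_bool (_ && _))%:R; exact: eq_sym.
Qed.

(** The twist is a permutation matrix, hence orthogonal. *)
Lemma vdet_vtwm_sqr a b : vdet (vtwm K a b) ^+ 2 = 1.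
Proof. by apply: vdet_sqr_orthogonal; rewrite /= vtwm_mxT vtwmK. Qed.

Lemma vdet_vtwm0 b : vdet (vtwm K 0 b) = 1.
Proof. by rewrite /vdet; exact: det_mx00. Qed.

Lemma vdet_vtwm1 b : vdet (vtwm K 1 b) = 1.
Proof.
rewrite /vdet -[RHS](det1 K (1 * b)); congr (\det _).
apply/matrixP => p q; rewrite castmxE cast_ord_id.
set p' := cast_ord _ p; have : p' = p :> nat by [].
case: (mxtens_indexP p') => j' i'; case: (mxtens_indexP q) => i j /= pE.
rewrite vtwm_mxE mxE -[in RHS]val_eqE /= -pE.
by rewrite !ord1 eqxx mul0n muln1 addn0.
Qed.

Definition determinant_V : determinant_on K (V K).
Proof.
apply: (@DeterminantOn K (V K) Posz (fun a b f => larr_of (Lam_hom f))) => //.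
- by move=> a; apply: larr_eq; rewrite // /lsc /= vdetE det1.
- by move=> a b c g f; rewrite Lam_comp.
- move=> a a' b b' f g; apply: larr_eq => //.
  by rewrite [RHS]lscD /lsc /= vdet_add.
- by move=> a b; rewrite /lsc /= vdet_vtwa.
- by move=> a b; rewrite /lsc /= vdet_vtwm_sqr.
- by move=> a b [] [->]; rewrite /lsc /= ?vdet_vtwm0 ?vdet_vtwm1.
Defined.

End DeterminantV.

(** * Functors to (L, (x)) that are not monoidal *)

Lemma lsc_tensh (K : fieldType) (a a' b b' : Lmul K) (f : hom a a')
    (g : hom b b') :
  lsc (tensh f g : lhom K _ _) = lsc (f : lhom K _ _) ^ b * lsc (g : lhom K _ _) ^ a.
Proof. by rewrite [LHS]lscM (lhom_dom f) (lhom_dom g). Qed.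

(** All the morphisms of the hexagon other than the image of the associativity
    isomorphism are identities. *)
Lemma monoidal_lsc (K : fieldType) (C : monData) (F : prodFunctor C (Lmul K))
    (a b c : C) :
  monoidal F -> lsc (fhom F (assoc a b c) : lhom K _ _) = 1.
Proof.
move=> /(_ a b c) /(congr1 (fun f : lhom K _ _ => lsc f)).
rewrite !lsc_comp !lsc_tensh !idto_lsc.
by rewrite !exp1rz !mulr1 !mul1r.
Qed.

(** * A triple of matrices with sign -1 *)

Section Witness.
Variables (n : nat) (p q : 'I_n).
Hypothesis pq : (p < q)%N.

Let p_neq_q : p != q. Proof. by rewrite neq_ltn pq. Qed.

Definition shear (i j : 'I_n) := (i == j) || ((i == p) && (j == q)).
Definition swap (i j : 'I_n) := tperm p q i == j.

Lemma shear_row (i a b : 'I_n) : (a < b)%N -> shear i a -> shear i b ->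
  [/\ i = p, a = p & b = q].
Proof.
move=> ab; case/orP=> [/eqP ia|/andP[/eqP ip /eqP aq]];
  case/orP=> [/eqP ib|/andP[/eqP ip' /eqP bq]]; subst => //.
all: by move: ab; rewrite ?ltnn // ltnNge ltnW.
Qed.

Lemma shear_col (l a b : 'I_n) : (a < b)%N -> shear a l -> shear b l ->
  [/\ l = q, a = p & b = q].
Proof.
move=> ab; case/orP=> [/eqP ia|/andP[/eqP ip /eqP aq]];
  case/orP=> [/eqP ib|/andP[/eqP ip' /eqP bq]]; subst => //.
all: by move: ab; rewrite ?ltnn // ltnNge ltnW.
Qed.

Definition rel_mx (r : rel 'I_n) : 'M[int]_n := \matrix_(i, j) (r i j)%:R.

Lemma rel_mx_shear : rel_mx shear = 1%:M + delta_mx p q.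
Proof.
apply/matrixP => i j; rewrite !mxE /shear.
case: (i =P j) => [->|_] /=; last by rewrite add0r.
have [->|_] //= := eqVneq j p.
by rewrite (negPf p_neq_q) addr0.
Qed.

Lemma rel_mx_swap : rel_mx swap = perm_mx (tperm p q).
Proof. by apply/matrixP => i j; rewrite !mxE. Qed.

Lemma det_shear : \det (rel_mx shear) = 1.
Proof.
rewrite -det_tr det_trig.
  by rewrite big1 // => i _; rewrite !mxE /shear eqxx.
apply/is_trig_mxP => i j ij; rewrite !mxE /shear.
case: eqP ij => [->|_]; first by rewrite ltnn.
by case: eqP => [->|//]; case: eqP => [->|//]; rewrite ltnNge ltnW.
Qed.

Lemma det_swap : \det (rel_mx swap) = -1.
Proof. by rewrite rel_mx_swap det_perm odd_tperm p_neq_q. Qed.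

Definition witness_mx := rel_mx shear *m rel_mx swap *m rel_mx shear.

Lemma det_witness : \det witness_mx = -1.
Proof. by rewrite !det_mulmx det_swap det_shear mulr1 mul1r. Qed.

(** Write e_i for the i-th unit row vector. With S the shear and P the
    transposition, e_p S P S = (e_q + e_p) S = e_p + 2 e_q and
    e_q S P S = e_p S = e_p + e_q, so that rows p and q agree once e_q is
    subtracted from the former. *)
Lemma det_witness_delta : \det (witness_mx - delta_mx p q) = 0.
Proof.
pose e (i : 'I_n) : 'rV[int]_n := delta_mx 0 i.
have eS i : e i *m rel_mx shear = e i + e q *+ (i == p).
  by rewrite rel_mx_shear mulmxDr mulmx1 mul_delta_mx_cond.
have eP i : e i *m rel_mx swap = e (tperm p q i).
  by rewrite rel_mx_swap -rowE; apply/rowP => j; rewrite !mxE eqxx eq_sym.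
have qNp : (q == p) = false by rewrite eq_sym; exact: negPf.
have rowE_A : row p (witness_mx - delta_mx p q) = row q (witness_mx - delta_mx p q).
  rewrite !rowE !mulmxBr !mulmxA !eS !mul_delta_mx_cond eqxx qNp.
  rewrite !mulr1n mulr0n subr0 addr0 mulmxDl !eP.
  rewrite tpermL tpermR mulmxDl !eS eqxx qNp mulr0n addr0 mulr1n.
  by rewrite [e q + _]addrC addrK.
by apply: (determinant_alternate p_neq_q) => j; move/rowP/(_ j): rowE_A; rewrite !mxE.
Qed.

Section Sign.
Variables (K : fieldType) (B : bipermData) (d : determinant_on K B).

Definition obj_mx (r : rel 'I_n) : Mat B n :=
  fun i j => if r i j then oneo else zeroo.

Lemma dimo_obj_mx r i j : dimo d (obj_mx r i j) = (r i j)%:R.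
Proof. by rewrite /obj_mx; case: ifP => _; rewrite ?dimo0 ?dimo1. Qed.

(** A nonzero term of [lsc_mat_assoc] has two nonzero entries in row i of the
    first shear and two in column l of the last one. This forces i = p, l = q and
    determines all the summation indices. *)
Lemma lsc_assoc_witness i l :
  lsc (deth d (assoc (obj_mx shear) (obj_mx swap) (obj_mx shear) i l)) =
  (-1) ^+ ((i == p) && (l == q)).
Proof.
rewrite lsc_mat_assoc => [|j]; last first.
  by rewrite dimo_obj_mx; case: (shear i j); [right | left].
rewrite [RHS]exprnP; congr (_ ^ _).
pose term k k' j j' : int :=
  (shear i j)%:R * (swap j k)%:R * (shear k l)%:R *
  ((shear i j')%:R * (swap j' k')%:R * (shear k' l)%:R).
have term0 (k k' j j' : 'I_n) : (k < k')%N -> (j' < j)%N ->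
    ~~ [&& (i == p) && (l == q), k == p, k' == q, j == q & j' == p] ->
    term k k' j j' = 0.
  move=> kk' jj'; apply: contraNeq; rewrite /term -!natrM !mulnb pnatr_eq0 eqb0 negbK.
  case/andP=> /andP[/andP[ij _] kl] /andP[/andP[ij' _] k'l].
  have [-> -> ->] := shear_row jj' ij' ij.
  by have [-> -> ->] := shear_col kk' kl k'l; rewrite !eqxx.
transitivity (\sum_(k < n) \sum_(k' < n | (k < k')%N)
    \sum_(j < n) \sum_(j' < n | (j' < j)%N) term k k' j j').
  apply: eq_bigr => k _; apply: eq_bigr => k' _; apply: eq_bigr => j _.
  by apply: eq_bigr => j' _; rewrite !dimo_obj_mx.
(* Only the term with k = p, k' = q, j = q and j' = p can be nonzero. *)
rewrite (bigD1 p) //= [X in _ + X]big1 ?addr0; last first.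
  move=> k kp; rewrite big1 // => k' kk'; rewrite big1 // => j _.
  rewrite big1 // => j' jj'; apply: term0 => //.
  by rewrite (negPf kp) andbF.
rewrite (bigD1 q) //= [X in _ + X]big1 ?addr0; last first.
  move=> k' /andP[kk' kq]; rewrite big1 // => j _.
  rewrite big1 // => j' jj'; apply: term0 => //.
  by rewrite (negPf kq) !andbF.
rewrite (bigD1 q) //= [X in _ + X]big1 ?addr0; last first.
  move=> j jq; rewrite big1 // => j' jj'; apply: term0 => //.
  by rewrite (negPf jq) !andbF.
rewrite (bigD1 p) //= [X in _ + X]big1 ?addr0; last first.
  move=> j' /andP[jj' jp]; apply: term0 => //.
  by rewrite (negPf jp) !andbF.
have [/andP[/eqP ip /eqP lq]|il] := boolP ((i == p) && (l == q)).
  by rewrite /term /shear /swap ip lq tpermL tpermR !eqxx !orbT.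
by apply: term0 => //; rewrite (negPf il).
Qed.

End Sign.
End Witness.

(** * Determinant functors on matrix categories *)

Section DeterminantFunctor.
Variables (K : fieldType) (B : bipermData) (d : determinant_on K B) (n : nat).
Variable D : prodFunctor (Mat B n) (Lmul K).
Hypothesis fhomE : forall E F (f : hom E F),
  larr_of (fhom D f : lhom K _ _) = \det (\matrix_(i, j) deth d (f i j)).

Let dim_mx (E : Mat B n) : 'M[int]_n := \matrix_(i, j) dimo d (E i j).

Lemma fobE E : D E = \det (dim_mx E).
Proof.
rewrite -(lhom_dom (fhom D (idm E) : lhom K _ _)) fhomE -(det_map_mx (@ldeg K)).
by congr (\det _); apply/matrixP => i j; rewrite !mxE; exact: ldeg_deth.
Qed.

Lemma dim_mx_mul E F : dim_mx (tens E F) = dim_mx E *m dim_mx F.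
Proof.
apply/matrixP => i k; rewrite !mxE dimo_osum.
by apply: eq_bigr => j _; rewrite !mxE dimoM.
Qed.

Lemma dim_obj_mx r : dim_mx (obj_mx B r) = rel_mx r.
Proof. by apply/matrixP => i j; rewrite !mxE dimo_obj_mx. Qed.

Lemma lsc_fhom_assoc_sqr E F G :
  lsc (fhom D (assoc E F G) : lhom K _ _) ^+ 2 = 1.
Proof.
by rewrite fhomE; apply: lsc_det_sqr => i j; rewrite mxE lsc_mat_assoc_sqr.
Qed.

Lemma lsc_fhom_assoc_witness (p q : 'I_n) : (p < q)%N ->
  lsc (fhom D (assoc (obj_mx B (shear p q)) (obj_mx B (swap p q))
                     (obj_mx B (shear p q))) : lhom K _ _) = -1.
Proof.
move=> pq; rewrite fhomE (det_one_sign (det_witness_delta pq)) => [|i j].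
  rewrite det_witness // lsc_mul /= lsc_lint exp1rz mulr1.
  by rewrite [lsc _]mul1r exprN1 invrN1.
set E := obj_mx B _; set F := obj_mx B _.
have <- : dim_mx (tens (tens E F) E) = witness_mx p q.
  by rewrite !dim_mx_mul !dim_obj_mx.
rewrite !mxE; apply: larr_eq.
  by rewrite ldeg_deth ldeg_add raddfMn mul0rn addr0.
rewrite lsc_assoc_witness // lsc_add mul1r.
by case: (_ && _).
Qed.

Lemma det_functor_assoc : (1 < n)%N -> -1 != 1 :> K ->
  [/\ ~ monoidal D, ~ monoidal (restrict_Gl D),
      forall E F G : Mat B n, exists (e : int) (s : K),
        (s = 1 \/ s = -1) /\ arrow (fhom D (assoc E F G)) = (e, s) &
      exists (E F G : Gl D) (e : int),
        arrow (fhom (restrict_Gl D) (assoc E F G)) = (e, -1)].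
Proof.
move=> n1 K2.
pose p := Ordinal (ltnW n1); pose q := Ordinal n1.
have pq : (p < q)%N by [].
have shearGl : weakly_invertible D (obj_mx B (shear p q)).
  by rewrite /weakly_invertible fobE dim_obj_mx det_shear.
have swapGl : weakly_invertible D (obj_mx B (swap p q)).
  by rewrite /weakly_invertible fobE dim_obj_mx det_swap.
have wit := lsc_fhom_assoc_witness pq.
pose E : Gl D := exist (fun X => weakly_invertible D X) _ shearGl.
pose F : Gl D := exist (fun X => weakly_invertible D X) _ swapGl.
split.
- by move/monoidal_lsc => mD; move: K2; rewrite -wit mD eqxx.
- move/monoidal_lsc => /(_ E F E) mD; move: K2.
  by rewrite -wit -[X in _ != X]mD eqxx.
- move=> X Y Z; set f := fhom D _.
  exists (ldeg (larr_of f)), (lsc (larr_of f)); split.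
    have /eqP := lsc_fhom_assoc_sqr X Y Z.
    by rewrite sqrf_eq1 => /orP[] /eqP; [left | right].
  by rewrite /arrow [LHS]surjective_pairing.
- exists E, F, E; set f := fhom (restrict_Gl D) _.
  exists (ldeg (larr_of f)); rewrite -[in RHS]wit.
  by rewrite /arrow [LHS]surjective_pairing.
Qed.

End DeterminantFunctor.

Unset Implicit Arguments.

Theorem lemma2p11 (R : realType) (n : nat) (hn : (1 < n)%N) :
  [/\ ~ monoidal (detL R[i] n),
      ~ monoidal (DetV R[i] n),
      ~ monoidal (restrict_Gl (detL R[i] n)) &
      ~ monoidal (restrict_Gl (DetV R[i] n))] /\
  [/\ forall E F G : Mat (L R[i]) n, exists (d : int) (s : R[i]),
        (s = 1 \/ s = -1) /\ arrow (fhom (detL R[i] n) (assoc E F G)) = (d, s),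
      forall E F G : Mat (V R[i]) n, exists (d : int) (s : R[i]),
        (s = 1 \/ s = -1) /\ arrow (fhom (DetV R[i] n) (assoc E F G)) = (d, s),
      exists (E F G : Gl (detL R[i] n)) (d : int),
        arrow (fhom (restrict_Gl (detL R[i] n)) (assoc E F G)) = (d, -1) &
      exists (E F G : Gl (DetV R[i] n)) (d : int),
        arrow (fhom (restrict_Gl (DetV R[i] n)) (assoc E F G)) = (d, -1)].
Proof.
have K2 : -1 != 1 :> R[i] by rewrite eq_sym -subr_eq0 opprK -mulr2n pnatr_eq0.
have [L1 L2 L3 L4] := det_functor_assoc (d := determinant_L R[i])
  (D := detL R[i] n) (fun _ _ _ => erefl) hn K2.
have [V1 V2 V3 V4] := det_functor_assoc (d := determinant_V R[i])
  (D := DetV R[i] n) (fun _ _ _ => erefl) hn K2.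
by [].
Qed.
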